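(* Let $a<b$ be real numbers, $\lambda,\mu\in[0,1]$ and $x\in\left[a,\frac{a+b}{2}\right]$, and suppose $(\lambda,\mu,x)$ falls under one of the following cases, with the associated constant $C$: Case 1: $\lambda=1$; $C=\frac{(b-a)^2}{12}$. Case 2: $x=\frac{a+b}{2}$ and $\lambda\ne\frac13$; $C=\frac{1}{24}(b-a)^2(8\lambda^3-3\lambda+1)$ if $\lambda\in[0,\frac12)$, and $C=\frac{1}{24}(b-a)^2(3\lambda-1)$ if $\lambda\in[\frac12,1]$. Case 3: $\mu=\frac12$, $\lambda\in[0,\frac13)$ and $x\ne\frac12\left[a+b-(b-a)\sqrt{\frac{\frac13-\lambda}{1-\lambda}}\right]$; $C=C^*(x,\lambda)$. Case 4: $\mu=\frac12$ and either $\lambda\in(\frac13,\frac12)$, with $C=C^*(x,\lambda)$, or $\lambda\in(\frac12,1)$, with $C=\frac{(b-a)^2}{12}+\frac12(1-\lambda)(b-x)(a-x)$. Here $$C^*(x,\lambda)=\begin{cases}\frac{(b-a)^2}{12}+\frac12(1-\lambda)(a-x)(b-x), & x\in[a,a+\lambda(b-a)],\\[2pt] \frac16(b-a)^2\left[1+\frac{4(1-\lambda)(a-x)}{b-a}\right]^{3/2}-\frac1{12}(b-a)^2(1-4\lambda^3)-\frac12(1-\lambda)(a-x)(b-x), & x\in\left(a+\lambda(b-a),a+\frac{b-a}{4(1-\lambda)}\right),\\[2pt] \frac{(4\lambda^3-1)(b-a)^2}{12}+\frac12(1-\lambda)(b-x)(x-a), & x\in\left[a+\frac{b-a}{4(1-\lambda)},\frac{a+b}{2}\right].\end{cases}$$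 Then for every $f\in C[a,b]$, $$|E(f;\lambda,\mu;x)|\le 4.5\cdot\omega_2\left(f;\sqrt{\frac{C}{2}}\right).$$
   Context: For $f\in C[a,b]$, $$E(f;\lambda,\mu;x):=\frac{1}{b-a}\int_a^b f(t)\,dt-\left\{\lambda\frac{f(a)+f(b)}{2}+(1-\lambda)\left[\mu f(x)+(1-\mu)f(a+b-x)\right]\right\}.$$ The second modulus of smoothness is $\omega_2(f;h)=\sup\{|f(y-t)-2f(y)+f(y+t)|:\ y\pm t\in[a,b],\ 0\le t\le h\}$. *)

(* Defs.v *)
(* Stdlib reals with Coquelicot. *)
From Stdlib Require Import Reals.
From Coquelicot Require Import Coquelicot.
Open Scope R_scope.

(* C[a,b]: continuity is relative to the segment, hence one-sided at a and b;
   values of f outside [a,b] are irrelevant throughout. *)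
Definition continuous_on_segment (a b : R) (f : R -> R) : Prop :=
  continuous_on (fun x => a <= x <= b) f.

Definition E_functional (a b : R) (f : R -> R) (lam mu x : R) : R :=
  1 / (b - a) * RInt f a b
  - (lam * ((f a + f b) / 2)
     + (1 - lam) * (mu * f x + (1 - mu) * f (a + b - x))).

Definition omega2_set (a b : R) (f : R -> R) (h : R) : R -> Prop :=
  fun z => exists y t : R,
    a <= y - t <= b /\ a <= y + t <= b /\ 0 <= t <= h /\
    z = Rabs (f (y - t) - 2 * f y + f (y + t)).

(* For f in C[a,b] with a <= b and h >= 0 the set is nonempty and bounded, so
   the extended-real supremum is finite and [real] loses nothing. *)
Definition omega2 (a b : R) (f : R -> R) (h : R) : R :=
  real (Lub_Rbar (omega2_set a b f h)).

(* The three branches cover a <= x <= (a+b)/2 when 0 <= lam < 1/2. In the middle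
   branch the base of the power is positive, so [Rpower] is the usual power. *)
Definition Cstar (a b x lam : R) : R :=
  if Rle_dec x (a + lam * (b - a)) then
    (b - a) ^ 2 / 12 + 1 / 2 * (1 - lam) * (a - x) * (b - x)
  else if Rlt_dec x (a + (b - a) / (4 * (1 - lam))) then
    1 / 6 * (b - a) ^ 2
      * Rpower (1 + 4 * (1 - lam) * (a - x) / (b - a)) (3 / 2)
    - 1 / 12 * (b - a) ^ 2 * (1 - 4 * lam ^ 3)
    - 1 / 2 * (1 - lam) * (a - x) * (b - x)
  else
    (4 * lam ^ 3 - 1) * (b - a) ^ 2 / 12
    + 1 / 2 * (1 - lam) * (b - x) * (x - a).

(* [error_case a b lam mu x C]: the parameters fall under one of the cases, with
   associated constant C. The cases may overlap. *)
Inductive error_case (a b lam mu x : R) : R -> Prop :=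
| case1 :
    lam = 1 ->
    error_case a b lam mu x ((b - a) ^ 2 / 12)
| case2_low :
    x = (a + b) / 2 -> lam <> 1 / 3 -> 0 <= lam < 1 / 2 ->
    error_case a b lam mu x
      (1 / 24 * (b - a) ^ 2 * (8 * lam ^ 3 - 3 * lam + 1))
| case2_high :
    x = (a + b) / 2 -> lam <> 1 / 3 -> 1 / 2 <= lam <= 1 ->
    error_case a b lam mu x (1 / 24 * (b - a) ^ 2 * (3 * lam - 1))
| case3 :
    mu = 1 / 2 -> 0 <= lam < 1 / 3 ->
    x <> 1 / 2 * (a + b - (b - a) * sqrt ((1 / 3 - lam) / (1 - lam))) ->
    error_case a b lam mu x (Cstar a b x lam)
| case4_low :
    mu = 1 / 2 -> 1 / 3 < lam < 1 / 2 ->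
    error_case a b lam mu x (Cstar a b x lam)
| case4_high :
    mu = 1 / 2 -> 1 / 2 < lam < 1 ->
    error_case a b lam mu x
      ((b - a) ^ 2 / 12 + 1 / 2 * (1 - lam) * (b - x) * (a - x)).

(* Main.v *)
Require Import Defs.
From Stdlib Require Import Reals Lra Psatz.
From Coquelicot Require Import Coquelicot.
Open Scope R_scope.

(** Zhuk's smoothing. Write W for the modulus of f at h = sqrt (C/2). Extend f
    beyond a and b by nearly best affine approximations on [a,a+2h] and [b-2h,b];
    by alternation their error is about W/2. The symmetric second differences of the
    extension at points of [a,b] with step at most h are then at most 3W/2, so its
    second Steklov mean g satisfies |f - g| <= 3W/4 and |g''| <= (3/2) W / h^2 on
    [a,b]. The functional E has norm at most 2, and C is the L^1 norm of its Peano
    kernel, so |E f| <= 2 (3W/4) + C (3/2) W / (C/2) = (9/2) W. *)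

(** Every admissible case makes E symmetric about the midpoint m of [a,b]. Folding g into G(s) =
    g(m+s) + g(m-s) moves the kernel analysis to [0,L] with L = (b-a)/2, where the kernel has few
    sign patterns and G'(0) = 0 removes one boundary term. The end segments of length 2h must fit
    inside [a,b]; this is the bound C <= 2 L^2. The extended function may jump at a and b, so g is
    C^1 but g'' exists only off a finite set. Estimates on g'' are therefore made by comparing
    increments of explicit antiderivatives rather than by integrating g''. The alternation is
    reached only up to a slack d, which is why W is enlarged slightly and the slack is sent to 0 at
    the end. *)

(** * Near-best affine approximation on a segment *)

Definition diff2 (F : R -> R) (x t : R) : R := F (x - t) - 2 * F x + F (x + t).

(* At the threshold slope q the maximizers and minimizers of f(x) - q x exchange
   their order, which gives an alternation at three points up to [d]. *)
Lemma near_best_line (a c : R) (f : R -> R) (W d : R) :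
  a < c -> 0 < d ->
  (forall x, a <= x <= c -> continuity_pt f x) ->
  (forall y t, a <= y - t -> y + t <= c -> 0 <= t -> Rabs (diff2 f y t) <= W) ->
  exists p q, forall x, a <= x <= c -> Rabs (f x - (p + q * x)) <= W / 2 + d.
Proof.
  intros hac hd hf hW.
  pose (r := fun q x => f x - q * x).
  pose (ismax := fun q u => a <= u <= c /\ forall x, a <= x <= c -> r q x <= r q u).
  pose (ismin := fun q v => a <= v <= c /\ forall x, a <= x <= c -> r q v <= r q x).
  assert (rcont : forall q x, a <= x <= c -> continuity_pt (r q) x).
  { intros q x hx. apply continuity_pt_minus; [now apply hf|].
    apply derivable_continuous_pt. apply ex_derive_Reals_0. auto_derive. auto. }
  assert (exmax : forall q, exists u, ismax q u).
  { intros q. destruct (continuity_ab_maj (r q) a c) as [u [hu1 hu2]];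
      [lra | apply rcont | exists u; split; auto]. }
  assert (exmin : forall q, exists u, ismin q u).
  { intros q. destruct (continuity_ab_min (r q) a c) as [u [hu1 hu2]];
      [lra | apply rcont | exists u; split; auto]. }
  (* Steep positive slopes force this order of the extremal points and steep negative slopes the
     opposite one; [s] below is the supremum of the slopes where it fails. *)
  pose (A := fun q => exists u v, ismax q u /\ ismin q v /\ u <= v).
  assert (bnd : exists K, 0 < K /\ forall x y, a <= x <= c -> a <= y <= c -> f x - f y < K).
  { destruct (exmax 0) as [u [hu hu']]. destruct (exmin 0) as [v [hv hv']].
    exists (r 0 u - r 0 v + 1). split.
    - specialize (hu' v hv). lra.
    - intros x y hx hy. specialize (hu' x hx). specialize (hv' y hy).
      unfold r in *. lra. }
  destruct bnd as [K [hK hKb]].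
  pose (Q := 2 * K / (c - a)).
  assert (hQ : Q * (c - a) = 2 * K) by (unfold Q; field; lra).
  assert (hQ0 : 0 < Q) by (unfold Q; apply Rdiv_lt_0_compat; lra).
  assert (Abig : forall q, Q <= q -> A q).
  { intros q hq. destruct (exmax q) as [u hu]. destruct (exmin q) as [v hv].
    exists u, v. split; [auto|split; [auto|]].
    destruct hu as [hu hu']. destruct hv as [hv hv'].
    assert (h1 := hu' a ltac:(lra)). assert (h2 := hv' c ltac:(lra)).
    assert (h3 := hKb u a hu ltac:(lra)). assert (h4 := hKb c v ltac:(lra) hv).
    unfold r in *.
    assert (q * (u - v) <= 2 * K - q * (c - a)) by lra.
    assert (q * (u - v) <= 0) by nra. nra. }
  assert (Asmall : ~ A (- Q)).
  { intros [u [v [[hu hu'] [[hv hv'] huv]]]].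
    assert (h1 := hu' c ltac:(lra)). assert (h2 := hv' a ltac:(lra)).
    assert (h3 := hKb u c hu ltac:(lra)). assert (h4 := hKb a v ltac:(lra) hv).
    unfold r in *. nra. }
  destruct (completeness (fun q => ~ A q)) as [s [hs1 hs2]].
  { exists Q. intros q hq. destruct (Rle_dec q Q); auto.
    exfalso. apply hq, Abig. lra. }
  { exists (- Q). exact Asmall. }
  (* Changing the slope by less than [e] changes differences of [r] on [a,c] by at most d/2. Slopes
     q > s and q' <= s within [e] of each other have opposite orders, so extremal points for q' are
     extremal for q up to d/2. *)
  pose (e := d / (2 * (c - a))).
  assert (he : 0 < e) by (unfold e; apply Rdiv_lt_0_compat; lra).
  assert (hec : 2 * (e * (c - a)) = d) by (unfold e; field; lra).
  assert (hA : A (s + e / 2)).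
  { apply Classical_Prop.NNPP. intro h. specialize (hs1 _ h). lra. }
  assert (hB : exists q', s - e / 2 < q' /\ ~ A q').
  { apply Classical_Prop.NNPP. intro h.
    assert (s <= s - e / 2); [|lra].
    apply hs2. intros q' hq'. apply Rnot_lt_le. intro. apply h. now exists q'. }
  destruct hB as [q' [hq' hnA]]. assert (hq's := hs1 _ hnA).
  set (q := s + e / 2) in *.
  destruct hA as [u [v [[hu hu'] [[hv hv'] huv]]]].
  destruct (exmax q') as [u1 hu1]. destruct (exmin q') as [v1 hv1].
  assert (huv1 : v1 < u1).
  { apply Rnot_le_lt. intro. apply hnA. exists u1, v1. auto. }
  destruct hu1 as [hu1 hu1']. destruct hv1 as [hv1 hv1'].
  assert (hqq : 0 < q - q' < e) by (unfold q; lra).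
  assert (tilt : forall y z, a <= y <= c -> a <= z <= c ->
    (q - q') * (y - z) <= d / 2).
  { intros y z hy hz.
    assert ((q - q') * (y - z) <= (q - q') * (c - a)) by (apply Rmult_le_compat_l; lra).
    assert ((q - q') * (c - a) <= e * (c - a)) by (apply Rmult_le_compat_r; lra).
    lra. }
  assert (hM1 : r q u - d / 2 <= r q u1).
  { specialize (hu1' u hu). specialize (tilt u1 u hu1 hu). unfold r in *. lra. }
  assert (hm1 : r q v1 <= r q v + d / 2).
  { specialize (hv1' v hv). specialize (tilt v v1 hv hv1). unfold r in *. lra. }
  assert (hr2 : forall y t, diff2 f y t = diff2 (r q) y t) by (intros; unfold diff2, r; ring).
  assert (hW' : forall y t, a <= y - t -> y + t <= c -> 0 <= t ->
     - W <= diff2 (r q) y t <= W).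
  { intros y t h1 h2 h3. rewrite <- hr2. apply Rabs_le_between. auto. }
  unfold diff2 in hW'.
  (* Either u <= v < u1 is a max-min-max pattern or v1 < u1 <= v is min-max-min. Centre the second
     difference at the middle point with the shorter arm as step: one end hits an outer extremum,
     and the other stays in [a,c], where extremality of the opposite kind bounds the value.
     Near-extremality costs at most three times d/2. *)
  assert (hD : r q u - r q v <= W + 3 * (d / 2)).
  { destruct (Rlt_dec v u1) as [hlt | hge].
    - destruct (Rle_dec (v - u) (u1 - v)).
      + specialize (hW' v (v - u) ltac:(lra) ltac:(lra) ltac:(lra)).
        replace (v - (v - u)) with u in hW' by ring.
        specialize (hv' (v + (v - u)) ltac:(lra)). lra.
      + specialize (hW' v (u1 - v) ltac:(lra) ltac:(lra) ltac:(lra)).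
        replace (v + (u1 - v)) with u1 in hW' by ring.
        specialize (hv' (v - (u1 - v)) ltac:(lra)). lra.
    - destruct (Rle_dec (u1 - v1) (v - u1)).
      + specialize (hW' u1 (u1 - v1) ltac:(lra) ltac:(lra) ltac:(lra)).
        replace (u1 - (u1 - v1)) with v1 in hW' by ring.
        specialize (hu' (u1 + (u1 - v1)) ltac:(lra)). lra.
      + specialize (hW' u1 (v - u1) ltac:(lra) ltac:(lra) ltac:(lra)).
        replace (u1 + (v - u1)) with v in hW' by ring.
        specialize (hu' (u1 - (v - u1)) ltac:(lra)). lra. }
  exists ((r q u + r q v) / 2), q. intros x hx.
  specialize (hu' x hx). specialize (hv' x hx).
  replace (f x) with (r q x + q * x) by (unfold r; ring).
  apply Rabs_le. lra.
Qed.


(** * Mean value inequalities with finitely many exceptional points *)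

(** Both Q + A and Q - A have nonnegative derivative, so the mean value theorem applies to each.
    This stands in for integrating |dA| <= dQ, so nothing has to be shown about integrability of
    [dA]. *)
Lemma increment_le_open (A Q dA dQ : R -> R) (p q : R) :
  p <= q ->
  (forall s, p <= s <= q -> continuity_pt A s) ->
  (forall s, p <= s <= q -> continuity_pt Q s) ->
  (forall s, p < s < q ->
     is_derive A s (dA s) /\ is_derive Q s (dQ s) /\ Rabs (dA s) <= dQ s) ->
  Rabs (A q - A p) <= Q q - Q p.
Proof.
  intros hpq hA hQ hd.
  destruct (Req_dec p q) as [<- | hne].
  { rewrite Rminus_diag, Rabs_R0. lra. }
  assert (gen : forall sg, sg = 1 \/ sg = -1 ->
            0 <= Q q - Q p + sg * (A q - A p)).
  { intros sg hsg. pose (D := fun s => Q s + sg * A s).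
    assert (hD : forall s, p < s < q -> is_derive D s (dQ s + sg * dA s)).
    { intros s hs. destruct (hd s hs) as [h1 [h2 _]].
      apply (is_derive_plus Q (fun s => sg * A s)); auto.
      now apply (is_derive_scal A). }
    assert (prD : forall s, p < s < q -> derivable_pt D s).
    { intros s hs. exists (dQ s + sg * dA s). now apply is_derive_Reals, hD. }
    destruct (MVT D id p q prD (fun s _ => derivable_pt_id s)) as [s [hs e]].
    - lra.
    - intros s hs. apply continuity_pt_plus; auto.
      apply continuity_pt_mult; auto. apply continuity_pt_const. intros ? ?; auto.
    - intros s _. apply derivable_continuous_pt, derivable_pt_id.
    - rewrite derive_pt_id in e.
      rewrite (derive_pt_eq_0 D s (dQ s + sg * dA s)) in e
        by now apply is_derive_Reals, hD.
      destruct (hd s hs) as [_ [_ h]]. apply Rabs_le_between in h.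
      unfold id, D in e.
      assert (0 <= (q - p) * (dQ s + sg * dA s)); [|lra].
      apply Rmult_le_pos; destruct hsg as [-> | ->]; lra. }
  assert (h1 := gen 1 ltac:(auto)). assert (h2 := gen (-1) ltac:(auto)).
  apply Rabs_le. lra.
Qed.

(** Continuity at an exceptional point lets the interval be cut there and the two increments
    added. *)
Lemma increment_le (l : list R) (A Q dA dQ : R -> R) (p q : R) :
  p <= q ->
  (forall s, p <= s <= q -> continuity_pt A s) ->
  (forall s, p <= s <= q -> continuity_pt Q s) ->
  (forall s, p < s < q -> ~ List.In s l ->
     is_derive A s (dA s) /\ is_derive Q s (dQ s) /\ Rabs (dA s) <= dQ s) ->
  Rabs (A q - A p) <= Q q - Q p.
Proof.
  revert p q. induction l as [|e l IH]; intros p q hpq hA hQ hd.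
  - apply (increment_le_open A Q dA dQ); auto.
  - destruct (Rlt_dec p e); [destruct (Rlt_dec e q)|].
    1: { assert (h1 : Rabs (A e - A p) <= Q e - Q p).
      { apply IH; [lra | intros; apply hA; lra | intros; apply hQ; lra |].
        intros s hs hn. apply hd; [lra|]. intros [->|]; [lra|auto]. }
      assert (h2 : Rabs (A q - A e) <= Q q - Q e).
      { apply IH; [lra | intros; apply hA; lra | intros; apply hQ; lra |].
        intros s hs hn. apply hd; [lra|]. intros [->|]; [lra|auto]. }
      apply Rabs_le_between in h1. apply Rabs_le_between in h2.
      apply Rabs_le. lra. }
    all: apply IH; auto; intros s hs hn; apply hd; auto; intros [->|]; [lra|auto].
Qed.

(** * The norm of the Peano kernel and its range *)

(* [kernel_case L sg lam C]: C is the mean over [0,L] of |K|, where K is the Peano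
   kernel s^2/2 + (1-lam) L (L-sg) - L^2/2 on [0,sg], (L-s)((1-2 lam) L-s)/2 on
   [sg,L]. The constructors list its possible sign patterns: -, (-,+,-) with first
   zero r, and (+,-). *)
Inductive kernel_case (L sg lam : R) : R -> Prop :=
| kernel_neg :
    (1 - 2 * lam) * L <= sg ->
    kernel_case L sg lam (L ^ 2 / 3 - (1 - lam) * (L ^ 2 - sg ^ 2) / 2)
| kernel_neg_pos_neg (r : R) :
    0 < r -> r ^ 2 = L ^ 2 - 2 * (1 - lam) * L * (L - sg) ->
    sg <= (1 - 2 * lam) * L ->
    kernel_case L sg lam
      (2 / 3 * r ^ 3 / L + (4 * lam ^ 3 - 1) * L ^ 2 / 3
       + (1 - lam) * (L ^ 2 - sg ^ 2) / 2)
| kernel_pos_neg :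
    L <= 2 * (1 - lam) * (L - sg) ->
    sg <= (1 - 2 * lam) * L ->
    kernel_case L sg lam
      ((4 * lam ^ 3 - 1) * L ^ 2 / 3 + (1 - lam) * (L ^ 2 - sg ^ 2) / 2).

(** Positivity makes h = sqrt (C/2) a legitimate step; the upper bound says h <= L, so the affine
    pieces of length 2h fit. *)
Lemma kernel_case_range (L sg lam C : R) :
  0 < L -> 0 <= sg <= L -> 0 <= lam <= 1 ->
  kernel_case L sg lam C -> 0 < C <= 2 * L ^ 2.
Proof.
  intros hL hsg hlam hC.
  pose (s1 := (1 - 2 * lam) * L). pose (w := s1 - sg).
  pose (b1 := (1 - lam) * L * (L - sg) - L ^ 2 / 2).
  assert (hpow : forall t, 0 <= t -> 0 <= t ^ 3) by (intros; now apply pow_le).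
  (* The left side adds the integral of the kernel over [0,sg] and of its absolute value over
     [sg,s1] and [s1,L], for sg <= s1. *)
  assert (hsum : sg ^ 3 / 6 + b1 * sg
      + ((L - s1) * w ^ 2 / 4 + w ^ 3 / 6) + (L - s1) ^ 3 / 12
    = L * ((4 * lam ^ 3 - 1) * L ^ 2 / 3 + (1 - lam) * (L ^ 2 - sg ^ 2) / 2)).
  { unfold w, b1, s1. field. }
  assert (hupper : sg <= s1 ->
    (4 * lam ^ 3 - 1) * L ^ 2 / 3 + (1 - lam) * (L ^ 2 - sg ^ 2) / 2 <= L ^ 2 / 2).
  { intro h. assert (hl : lam <= 1 / 2) by (unfold s1 in h; nra).
    assert (lam ^ 3 <= (1 / 2) ^ 3) by (apply pow_incr; lra).
    assert (0 <= L ^ 2) by apply pow2_ge_0. assert (0 <= sg ^ 2) by apply pow2_ge_0.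
    assert ((4 * lam ^ 3 - 1) * L ^ 2 <= 0) by nra.
    assert (0 <= L ^ 2 - sg ^ 2) by nra. nra. }
  assert (hLs : 0 <= L - s1) by (unfold s1; nra).
  destruct hC as [h | r hr hr2 h | h1 h].
  - split; [|nra].
    destruct (Rle_dec (1 / 2) lam); [nra|].
    assert (((1 - 2 * lam) * L) ^ 2 <= sg ^ 2) by (apply pow_incr; nra).
    assert ((1 - lam) * (L ^ 2 - sg ^ 2) <= (1 - lam) * (L ^ 2 - ((1 - 2 * lam) * L) ^ 2))
      by (apply Rmult_le_compat_l; lra).
    (* The coefficient is 4 lam (1-lam)^2, with maximum 16/27 at lam = 1/3; half of it, 8/27, is
       still below 1/3. *)
    replace ((1 - lam) * (L ^ 2 - ((1 - 2 * lam) * L) ^ 2)) with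
      ((16 / 27 - 4 * ((1 / 3 - lam) ^ 2 * (4 / 3 - lam))) * L ^ 2) in H0 by field.
    assert (0 <= (1 / 3 - lam) ^ 2 * (4 / 3 - lam))
      by (apply Rmult_le_pos; [apply pow2_ge_0 | lra]).
    nra.
  - fold s1 in h. specialize (hupper h).
    assert (hw : 0 <= w) by (unfold w; lra).
    assert (hb1 : b1 = - r ^ 2 / 2) by (unfold b1; rewrite hr2; field).
    assert (hrL : r <= L).
    { apply Rsqr_incr_0_var; [|lra]. unfold Rsqr.
      assert (0 <= (1 - lam) * L * (L - sg)) by (repeat apply Rmult_le_pos; lra). nra. }
    assert (h3 : 0 < r ^ 3) by now apply pow_lt.
    split.
    + apply (Rmult_lt_reg_l L); [lra|].
      replace (L * (2 / 3 * r ^ 3 / L + (4 * lam ^ 3 - 1) * L ^ 2 / 3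
        + (1 - lam) * (L ^ 2 - sg ^ 2) / 2)) with
        (2 / 3 * r ^ 3 + L * ((4 * lam ^ 3 - 1) * L ^ 2 / 3
        + (1 - lam) * (L ^ 2 - sg ^ 2) / 2)) by (field; lra).
      rewrite <- hsum, hb1.
      (* On [0,sg] the kernel is (s^2 - r^2)/2, and the integral of its absolute value is ((sg -
         r)^2 (sg + 2 r) + 2 r^3) / 6, at least r^3/3. *)
      assert (0 <= (sg - r) ^ 2 * (sg + 2 * r))
        by (apply Rmult_le_pos; [apply pow2_ge_0 | lra]).
      assert (0 <= (L - s1) * w ^ 2) by (apply Rmult_le_pos; [lra | apply pow2_ge_0]).
      assert (0 <= w ^ 3) by auto. assert (0 <= (L - s1) ^ 3) by auto. lra.
    + assert (0 <= L ^ 2) by apply pow2_ge_0. assert (r ^ 3 / L <= L ^ 2); [|lra].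
      apply (Rmult_le_reg_r L); [lra|].
      replace (r ^ 3 / L * L) with (r ^ 3) by (field; lra).
      replace (L ^ 2 * L) with (L ^ 3) by ring. apply pow_incr; lra.
  - fold s1 in h. specialize (hupper h). split; [|nra].
    assert (hw : 0 <= w) by (unfold w; lra).
    assert (hb1 : 0 <= b1) by (unfold b1; nra).
    apply (Rmult_lt_reg_l L); [lra|]. rewrite <- hsum, Rmult_0_r.
    assert (0 <= b1 * sg) by (apply Rmult_le_pos; lra).
    assert (0 <= (L - s1) * w ^ 2) by (apply Rmult_le_pos; [lra | apply pow2_ge_0]).
    assert (0 <= w ^ 3) by auto. assert (0 <= (L - s1) ^ 3) by auto.
    assert (0 <= sg ^ 3) by (apply hpow; lra).
    (* The three lengths add up to L > 0, so at least one of the cubes is strictly positive. *)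
    assert (hpos : sg + w + (L - s1) = L) by (unfold w; ring).
    destruct (Rlt_dec 0 sg); [assert (0 < sg ^ 3) by (now apply pow_lt); lra|].
    destruct (Rlt_dec 0 w); [assert (0 < w ^ 3) by (now apply pow_lt); lra|].
    assert (0 < (L - s1) ^ 3) by (apply pow_lt; lra). lra.
Qed.

Lemma continuity_pt_is_derive (F : R -> R) (x d : R) :
  is_derive F x d -> continuity_pt F x.
Proof.
  intro h. apply continuity_pt_filterlim.
  apply (ex_derive_continuous F). now exists d.
Qed.

(** * The Peano kernel estimate for the folded function *)

Section PeanoKernel.

Variables (L sg lam M : R) (l : list R) (Gam G dG ddG : R -> R).
Hypothesis hL : 0 < L.
Hypothesis hsg : 0 <= sg <= L.
Hypothesis hlam : 0 <= lam <= 1.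
Hypothesis hGam : forall s, is_derive Gam s (G s).
Hypothesis hG : forall s, is_derive G s (dG s).
Hypothesis hdG : forall s, continuity_pt dG s.
Hypothesis hddG : forall s, 0 < s < L -> ~ List.In s l ->
  is_derive dG s (ddG s) /\ Rabs (ddG s) <= M.
Hypothesis hdG0 : dG 0 = 0.

(* An antiderivative of (s^2/2 + al s + be) G''(s), from integrating by parts twice. *)
Let A (al be s : R) := (s ^ 2 / 2 + al * s + be) * dG s - (s + al) * G s + Gam s.
Let Q (al be s : R) := s ^ 3 / 6 + al * s ^ 2 / 2 + be * s.

(** Here [e] is the sign of the kernel on [p,q], so [M * e * Q] has derivative M |kernel|, which
    dominates the derivative of [A]. *)
Lemma peano_piece (al be e p q : R) :
  0 <= p <= q -> q <= L -> e = 1 \/ e = -1 ->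
  (forall s, p <= s <= q -> 0 <= e * (s ^ 2 / 2 + al * s + be)) ->
  Rabs (A al be q - A al be p) <= M * (e * (Q al be q - Q al be p)).
Proof.
  intros hp hq he hk.
  replace (M * (e * (Q al be q - Q al be p)))
    with (M * e * Q al be q - M * e * Q al be p) by ring.
  apply (increment_le l (A al be) (fun s => M * e * Q al be s)
    (fun s => (s ^ 2 / 2 + al * s + be) * ddG s)
    (fun s => M * e * (s ^ 2 / 2 + al * s + be))); [lra | | |].
  - intros s _. unfold A.
    apply continuity_pt_plus; [apply continuity_pt_minus|].
    + apply continuity_pt_mult; auto.
      apply (continuity_pt_is_derive _ _ (s + al)). auto_derive; auto. field.
    + apply continuity_pt_mult; [|now apply (continuity_pt_is_derive _ _ (dG s))].
      apply (continuity_pt_is_derive _ _ 1). auto_derive; auto.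
    + now apply (continuity_pt_is_derive _ _ (G s)).
  - intros s _. apply (continuity_pt_is_derive _ _ (M * e * (s ^ 2 / 2 + al * s + be))).
    unfold Q. auto_derive; auto. field.
  - intros s hs hn. destruct (hddG s ltac:(lra) hn) as [h1 h2]. split; [|split].
    + unfold A. auto_derive.
      * repeat split; auto; eexists; eauto.
      * replace (Derive (fun x : R => dG x) s) with (ddG s)
          by (symmetry; now apply is_derive_unique).
        replace (Derive (fun x : R => G x) s) with (dG s)
          by (symmetry; now apply is_derive_unique).
        replace (Derive (fun x : R => Gam x) s) with (G s)
          by (symmetry; now apply is_derive_unique).
        field.
    + unfold Q. auto_derive; auto. field.
    + rewrite Rabs_mult.
      assert (hks := hk s ltac:(lra)).
      assert (Rabs (s ^ 2 / 2 + al * s + be) = e * (s ^ 2 / 2 + al * s + be)) as ->.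
      { destruct he as [-> | ->]; [rewrite Rabs_right | rewrite Rabs_left1]; lra. }
      nra.
Qed.

Lemma peano_bound (C : R) :
  kernel_case L sg lam C ->
  Rabs (Gam L - Gam 0 - lam * L * G L - (1 - lam) * L * G sg) <= M * (L * C).
Proof.
  pose (a1 := 0). pose (b1 := (1 - lam) * L * (L - sg) - L ^ 2 / 2).
  pose (a2 := - (1 - lam) * L). pose (b2 := (1 - 2 * lam) * L ^ 2 / 2).
  (* The kernel is continuous at sg and zero at L, so the [dG] terms cancel there; at 0 the term
     dies by [hdG0]. Its slope drops by (1-lam) L at sg and equals lam L at L, which produces the
     two weights. *)
  assert (hT : Gam L - Gam 0 - lam * L * G L - (1 - lam) * L * G sg
     = (A a1 b1 sg - A a1 b1 0) + (A a2 b2 L - A a2 b2 sg)).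
  { unfold A, a1, b1, a2, b2. rewrite hdG0. field. }
  assert (k2 : forall s, s ^ 2 / 2 + a2 * s + b2 = (L - s) * ((1 - 2 * lam) * L - s) / 2)
    by (intro; unfold a2, b2; field).
  (* On [0,sg] the kernel is its value at sg minus a nonnegative term, so a nonpositive value at sg
     settles the sign of the whole piece. *)
  assert (k1 : forall s, s ^ 2 / 2 + a1 * s + b1
     = (L - sg) * ((1 - 2 * lam) * L - sg) / 2 - (sg ^ 2 - s ^ 2) / 2)
    by (intro; unfold a1, b1; field).
  assert (k1' : forall s, s ^ 2 / 2 + a1 * s + b1 = s ^ 2 / 2 + b1)
    by (intro; unfold a1; field).
  rewrite hT. intros [h | r hr hr2 h | h1 h].
  - assert (p1 := peano_piece a1 b1 (-1) 0 sg ltac:(lra) ltac:(lra) ltac:(auto)).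
    assert (p2 := peano_piece a2 b2 (-1) sg L ltac:(lra) ltac:(lra) ltac:(auto)).
    eapply Rle_trans; [apply Rabs_triang|].
    eapply Rle_trans; [apply Rplus_le_compat; [apply p1 | apply p2]|].
    + intros s hs. rewrite k1. nra.
    + intros s hs. rewrite k2. nra.
    + apply Req_le. unfold Q, a1, b1, a2, b2. field.
  - set (s1 := (1 - 2 * lam) * L) in *.
    (* sg^2 - r^2 is twice the kernel at sg, namely (L - sg)(s1 - sg). *)
    assert (hrs : r <= sg).
    { apply Rsqr_incr_0_var; [|lra]. unfold Rsqr.
      assert (0 <= (L - sg) * (s1 - sg)) by (apply Rmult_le_pos; lra).
      unfold s1 in *. nra. }
    assert (hs1 : s1 <= L) by (unfold s1; nra).
    replace (A a1 b1 sg - A a1 b1 0 + (A a2 b2 L - A a2 b2 sg)) with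
      ((A a1 b1 r - A a1 b1 0) + (A a1 b1 sg - A a1 b1 r)
       + (A a2 b2 s1 - A a2 b2 sg) + (A a2 b2 L - A a2 b2 s1)) by ring.
    assert (hb1 : b1 = - r ^ 2 / 2) by (unfold b1; rewrite hr2; field).
    assert (p1 : Rabs (A a1 b1 r - A a1 b1 0) <= M * (-1 * (Q a1 b1 r - Q a1 b1 0))).
    { apply peano_piece; try lra. intros s hs. rewrite k1', hb1. nra. }
    assert (p2 : Rabs (A a1 b1 sg - A a1 b1 r) <= M * (1 * (Q a1 b1 sg - Q a1 b1 r))).
    { apply peano_piece; try lra. intros s hs. rewrite k1', hb1. nra. }
    assert (p3 : Rabs (A a2 b2 s1 - A a2 b2 sg) <= M * (1 * (Q a2 b2 s1 - Q a2 b2 sg))).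
    { apply peano_piece; try lra. intros s hs. rewrite k2. nra. }
    assert (p4 : Rabs (A a2 b2 L - A a2 b2 s1) <= M * (-1 * (Q a2 b2 L - Q a2 b2 s1))).
    { apply peano_piece; try lra. intros s hs. rewrite k2. nra. }
    eapply Rle_trans; [apply Rabs_triang|].
    eapply Rle_trans; [apply Rplus_le_compat; [|exact p4]|].
    { eapply Rle_trans; [apply Rabs_triang|].
      apply Rplus_le_compat; [|exact p3].
      eapply Rle_trans; [apply Rabs_triang|].
      apply Rplus_le_compat; [exact p1 | exact p2]. }
    assert (hQr : Q a1 b1 r = - r ^ 3 / 3) by (unfold Q, a1; rewrite hb1; field).
    rewrite hQr. apply Req_le. unfold Q, a1, b1, a2, b2, s1. field. lra.
  - set (s1 := (1 - 2 * lam) * L) in *.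
    assert (hs1 : s1 <= L) by (unfold s1; nra).
    assert (hb1 : 0 <= b1) by (unfold b1; nra).
    assert (p1 : Rabs (A a1 b1 sg - A a1 b1 0) <= M * (1 * (Q a1 b1 sg - Q a1 b1 0))).
    { apply peano_piece; try lra. intros s hs. rewrite k1'. nra. }
    assert (p3 : Rabs (A a2 b2 s1 - A a2 b2 sg) <= M * (1 * (Q a2 b2 s1 - Q a2 b2 sg))).
    { apply peano_piece; try lra. intros s hs. rewrite k2. nra. }
    assert (p4 : Rabs (A a2 b2 L - A a2 b2 s1) <= M * (-1 * (Q a2 b2 L - Q a2 b2 s1))).
    { apply peano_piece; try lra. intros s hs. rewrite k2. nra. }
    replace (A a1 b1 sg - A a1 b1 0 + (A a2 b2 L - A a2 b2 sg)) with
      ((A a1 b1 sg - A a1 b1 0) + (A a2 b2 s1 - A a2 b2 sg)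
       + (A a2 b2 L - A a2 b2 s1)) by ring.
    eapply Rle_trans; [apply Rabs_triang|].
    eapply Rle_trans; [apply Rplus_le_compat; [|exact p4]|].
    { eapply Rle_trans; [apply Rabs_triang|].
      apply Rplus_le_compat; [exact p1 | exact p3]. }
    apply Req_le. unfold Q, a1, b1, a2, b2, s1. field.
Qed.

End PeanoKernel.

(** * From the functional E to the kernel *)

(** The parameter mu drops out because its weight vanishes (lam = 1), because x and a+b-x coincide,
    or because it is already 1/2. The constants match after substituting the half-length L and the
    distance sg from x to the midpoint. *)
Lemma error_case_kernel (a b lam mu x C : R) :
  a < b -> 0 <= lam <= 1 -> a <= x <= (a + b) / 2 ->
  error_case a b lam mu x C ->
  kernel_case ((b - a) / 2) ((a + b) / 2 - x) lam C /\
  forall f, E_functional a b f lam mu x = E_functional a b f lam (1 / 2) x.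
Proof.
  intros hab hlam hx hC.
  set (L := (b - a) / 2). set (sg := (a + b) / 2 - x).
  assert (hL : 0 < L) by (unfold L; lra).
  assert (hsg : 0 <= sg <= L) by (unfold sg, L; lra).
  assert (ha : a = (a + b) / 2 - L) by (unfold L; field).
  assert (hb : b = (a + b) / 2 + L) by (unfold L; field).
  assert (hxs : x = (a + b) / 2 - sg) by (unfold sg; field).
  assert (star : lam < 1 / 2 -> kernel_case L sg lam (Cstar a b x lam)).
  { intro hl. unfold Cstar.
    destruct (Rle_dec x (a + lam * (b - a))) as [h | h].
    - replace (_ + _) with (L ^ 2 / 3 - (1 - lam) * (L ^ 2 - sg ^ 2) / 2)
        by (unfold L, sg; field).
      apply kernel_neg. unfold L, sg. lra.
    - apply Rnot_le_lt in h.
      assert (hs1 : sg <= (1 - 2 * lam) * L) by (unfold sg, L; lra).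
      assert (hk : (b - a) / (4 * (1 - lam)) * (4 * (1 - lam)) = b - a) by (field; lra).
      destruct (Rlt_dec x (a + (b - a) / (4 * (1 - lam)))) as [h' | h'].
      (* L^2 B is the square of the first kernel zero, so r = L sqrt B and the power 3/2 turns into
         r^3 / L^3. *)
      + set (B := 1 + 4 * (1 - lam) * (a - x) / (b - a)).
        assert (hB : L ^ 2 * B = L ^ 2 - 2 * (1 - lam) * L * (L - sg))
          by (unfold B, L, sg; field; lra).
        assert (hB0 : 0 < B).
        { assert (0 < (b - a) * B).
          { replace ((b - a) * B) with ((b - a) - 4 * (1 - lam) * (x - a))
              by (unfold B; field; lra). nra. }
          nra. }
        assert (hsq : sqrt B ^ 2 = B) by (apply pow2_sqrt; lra).
        assert (hR : Rpower B (3 / 2) = sqrt B ^ 3).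
        { replace (3 / 2) with (1 + / 2) by field.
          rewrite Rpower_plus, Rpower_1, Rpower_sqrt by auto.
          rewrite <- hsq at 1. ring. }
        rewrite hR.
        replace (_ - _) with (2 / 3 * (L * sqrt B) ^ 3 / L
          + (4 * lam ^ 3 - 1) * L ^ 2 / 3 + (1 - lam) * (L ^ 2 - sg ^ 2) / 2)
          by (unfold L, sg; field; lra).
        apply kernel_neg_pos_neg; auto.
        * apply Rmult_lt_0_compat; auto. now apply sqrt_lt_R0.
        * rewrite Rpow_mult_distr, hsq. exact hB.
      + replace (_ + _) with
          ((4 * lam ^ 3 - 1) * L ^ 2 / 3 + (1 - lam) * (L ^ 2 - sg ^ 2) / 2)
          by (unfold L, sg; field).
        apply kernel_pos_neg; auto. unfold L, sg.
        apply Rnot_lt_le in h'. nra. }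
  destruct hC as [e | e _ h | e _ h | e h _ | e h | e h].
  - subst lam. split; [|intro; unfold E_functional; ring].
    replace (_ / 12) with (L ^ 2 / 3 - (1 - 1) * (L ^ 2 - sg ^ 2) / 2)
      by (unfold L; field).
    apply kernel_neg. lra.
  - assert (e' : sg = 0) by (unfold sg; lra).
    split.
    + rewrite e'. replace (_ * _) with
        ((4 * lam ^ 3 - 1) * L ^ 2 / 3 + (1 - lam) * (L ^ 2 - 0 ^ 2) / 2)
        by (unfold L; field).
      apply kernel_pos_neg; nra.
    + intro f. unfold E_functional. replace (a + b - x) with x by lra. field. lra.
  - assert (e' : sg = 0) by (unfold sg; lra).
    split.
    + rewrite e'. replace (_ * _) with (L ^ 2 / 3 - (1 - lam) * (L ^ 2 - 0 ^ 2) / 2)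
        by (unfold L; field).
      apply kernel_neg; nra.
    + intro f. unfold E_functional. replace (a + b - x) with x by lra. field. lra.
  - split; [apply star; lra | now rewrite e].
  - split; [apply star; lra | now rewrite e].
  - split; [| now rewrite e].
    replace (_ + _) with (L ^ 2 / 3 - (1 - lam) * (L ^ 2 - sg ^ 2) / 2)
      by (unfold L, sg; field).
    apply kernel_neg. nra.
Qed.

(** With [Gam] the integral of g over [m-s, m+s], the functional in [peano_bound] is 2 L E(g). The
    folded second derivative is bounded by 2 M, so the factors 2 L and 2 M leave M C. *)
Lemma E_le_smooth (a b lam x C M : R) (l : list R) (g dg ddg : R -> R) :
  a < b -> 0 <= lam <= 1 -> a <= x <= (a + b) / 2 ->
  kernel_case ((b - a) / 2) ((a + b) / 2 - x) lam C ->
  (forall s, is_derive g s (dg s)) ->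
  (forall s, continuity_pt dg s) ->
  (forall s, a < s < b -> ~ List.In s l -> is_derive dg s (ddg s) /\ Rabs (ddg s) <= M) ->
  Rabs (E_functional a b g lam (1 / 2) x) <= M * C.
Proof.
  intros hab hlam hx hC hg hdg hddg.
  set (L := (b - a) / 2) in *. set (m := (a + b) / 2) in *. set (sg := m - x) in *.
  assert (hL : 0 < L) by (unfold L; lra).
  assert (hma : m = a + L) by (unfold m, L; field).
  assert (hmb : m = b - L) by (unfold m, L; field).
  assert (hsg : 0 <= sg <= L) by (unfold sg; lra).
  assert (hI : forall s, is_derive (RInt g a) s (g s)).
  { intro s. apply (is_derive_RInt g _ a).
    - apply filter_forall. intro y. apply (@RInt_correct R_CompleteNormedModule).
      apply ex_RInt_continuous. intros z _. apply (ex_derive_continuous g). now exists (dg z).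
    - apply (ex_derive_continuous g). now exists (dg s). }
  (* An exceptional point of g can be met from either half, hence both e - m and m - e. *)
  assert (hb := peano_bound L sg lam (2 * M)
    (List.map (fun e => e - m) l ++ List.map (fun e => m - e) l)%list
    (fun s => RInt g a (m + s) - RInt g a (m - s))
    (fun s => g (m + s) + g (m - s))
    (fun s => dg (m + s) - dg (m - s))
    (fun s => ddg (m + s) + ddg (m - s)) hL
    hsg hlam).
  assert (hmid : forall (F dF : R -> R) s e,
    is_derive F (m + s) (dF (m + s)) -> is_derive F (m - s) (dF (m - s)) ->
    is_derive (fun s => F (m + s) + e * F (m - s)) s (dF (m + s) - e * dF (m - s))).
  { intros F dF s e h1 h2. auto_derive.
    - repeat split; auto; eexists; eauto.
    - replace (Derive (fun x : R => F x) (m + s)) with (dF (m + s))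
        by (symmetry; now apply is_derive_unique).
      replace (Derive (fun x : R => F x) (m + - s)) with (dF (m - s))
        by (symmetry; now apply is_derive_unique).
      ring. }
  specialize (hb
    ltac:(intro s;
      apply (is_derive_ext (fun s => RInt g a (m + s) + -1 * RInt g a (m - s)));
      [intro t; simpl; ring |];
      replace (g (m + s) + g (m - s)) with (g (m + s) - -1 * g (m - s)) by ring;
      now apply (hmid (RInt g a) g))
    ltac:(intro s;
      apply (is_derive_ext (fun s => g (m + s) + 1 * g (m - s)));
      [intro t; simpl; ring |];
      replace (dg (m + s) - dg (m - s)) with (dg (m + s) - 1 * dg (m - s)) by ring;
      now apply (hmid g dg))).
  assert (hE : RInt g a (m + L) - RInt g a (m - L) - (RInt g a (m + 0) - RInt g a (m - 0))
     - lam * L * (g (m + L) + g (m - L)) - (1 - lam) * L * (g (m + sg) + g (m - sg))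
     = 2 * L * E_functional a b g lam (1 / 2) x).
  { replace (m + L) with b by (unfold m, L; field).
    replace (m - L) with a by (unfold m, L; field).
    replace (m + sg) with (a + b - x) by (unfold sg, m; field).
    replace (m - sg) with x by (unfold sg, m; field).
    rewrite Rplus_0_r, Rminus_0_r, RInt_point. unfold zero; simpl.
    unfold E_functional, L. field. lra. }
  cbv beta in hb. rewrite hE, Rabs_mult, Rabs_right in hb by lra.
  apply (Rmult_le_reg_l (2 * L)); [lra|].
  replace (2 * L * (M * C)) with (2 * M * (L * C)) by ring.
  apply hb; auto.
  - intro s. apply continuity_pt_minus.
    + apply (continuity_pt_comp (fun s => m + s) dg); auto.
      apply (continuity_pt_is_derive _ _ 1). auto_derive; auto.
    + apply (continuity_pt_comp (fun s => m - s) dg); auto.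
      apply (continuity_pt_is_derive _ _ (-1)). auto_derive; auto.
  - intros s hs hn.
    assert (n1 : ~ List.In (m + s) l).
    { intro h. apply hn, List.in_or_app. left. apply List.in_map_iff.
      exists (m + s). split; [ring|auto]. }
    assert (n2 : ~ List.In (m - s) l).
    { intro h. apply hn, List.in_or_app. right. apply List.in_map_iff.
      exists (m - s). split; [ring|auto]. }
    destruct (hddg (m + s)) as [h1 h1']; auto; [lra|].
    destruct (hddg (m - s)) as [h2 h2']; auto; [lra|].
    split.
    + apply (is_derive_ext (fun s => dg (m + s) + -1 * dg (m - s))).
      { intro t. simpl. ring. }
      replace (ddg (m + s) + ddg (m - s)) with (ddg (m + s) - -1 * ddg (m - s)) by ring.
      now apply (hmid dg ddg).
    + eapply Rle_trans; [apply Rabs_triang|]. lra.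
  - rewrite Rplus_0_r, Rminus_0_r. ring.
Qed.

(** * Affine extension and second Steklov mean *)

Section ZhukSmoothing.

Variables (a b h W p1 q1 p2 q2 : R) (f : R -> R).
Hypothesis hh : 0 < h <= (b - a) / 2.
Hypothesis hf : forall x, continuity_pt f x.
Hypothesis hW : forall y t, a <= y - t -> y + t <= b -> 0 <= t <= h ->
  Rabs (diff2 f y t) <= W.
Hypothesis hl : forall x, a <= x <= a + 2 * h -> Rabs (f x - (p1 + q1 * x)) <= W / 2.
Hypothesis hr : forall x, b - 2 * h <= x <= b -> Rabs (f x - (p2 + q2 * x)) <= W / 2.

(* In general discontinuous at a and b: this is why derivatives are only controlled
   off a finite list of points. *)
Definition affine_extension (x : R) : R :=
  if Rlt_dec x a then p1 + q1 * x else if Rlt_dec b x then p2 + q2 * x else f x.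

Let F := affine_extension.

Lemma affine_extension_l x : x < a -> F x = p1 + q1 * x.
Proof. intro. unfold F, affine_extension. destruct (Rlt_dec x a); lra. Qed.

Lemma affine_extension_r x : a < b -> b < x -> F x = p2 + q2 * x.
Proof.
  intros. unfold F, affine_extension.
  destruct (Rlt_dec x a); destruct (Rlt_dec b x); lra.
Qed.

Lemma affine_extension_m x : a <= x <= b -> F x = f x.
Proof.
  intro. unfold F, affine_extension.
  destruct (Rlt_dec x a); destruct (Rlt_dec b x); lra.
Qed.

(** Affine functions have zero second difference. If one end leaves [a,b], only the errors of the
    line at x (weight 2) and at the other end (weight 1) remain, which gives 3 (W/2); since 2h <=
    b-a, that other end stays on the segment where the line is good. *)
Lemma diff2_affine_extension (x t : R) :
  a <= x <= b -> 0 <= t <= h -> Rabs (diff2 F x t) <= 3 / 2 * W.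
Proof.
  intros hx ht. unfold diff2.
  assert (hW0 : 0 <= W).
  { assert (h1 := Rabs_pos (f a - (p1 + q1 * a))). assert (h2 := hl a ltac:(lra)). lra. }
  rewrite (affine_extension_m x hx).
  destruct (Rlt_dec (x - t) a) as [c1 | c1]; [|destruct (Rlt_dec b (x + t)) as [c2 | c2]].
  - rewrite (affine_extension_l (x - t)), affine_extension_m by lra.
    assert (h1 := hl x ltac:(lra)). assert (h2 := hl (x + t) ltac:(lra)).
    apply Rabs_le_between in h1. apply Rabs_le_between in h2. apply Rabs_le. lra.
  - rewrite (affine_extension_r (x + t)), affine_extension_m by lra.
    assert (h1 := hr x ltac:(lra)). assert (h2 := hr (x - t) ltac:(lra)).
    apply Rabs_le_between in h1. apply Rabs_le_between in h2. apply Rabs_le. lra.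
  - rewrite !affine_extension_m by lra. specialize (hW x t ltac:(lra) ltac:(lra) ht).
    unfold diff2 in hW. lra.
Qed.

Lemma continuous_affine (p q x : R) : continuous (fun y => p + q * y) x.
Proof.
  apply (ex_derive_continuous (fun y => p + q * y)). auto_derive. auto.
Qed.

Lemma ex_RInt_affine_extension (u v : R) : a < b -> ex_RInt F u v.
Proof.
  intro hab.
  assert (hc : forall x, continuous f x)
    by (intro; now apply continuity_pt_filterlim).
  assert (hm : forall v, a <= v <= b -> ex_RInt F a v).
  { intros w hw. apply (ex_RInt_ext f).
    - rewrite Rmin_left, Rmax_right by lra. intros. symmetry. apply affine_extension_m. lra.
    - now apply (@ex_RInt_continuous R_CompleteNormedModule). }
  assert (ha : forall v, ex_RInt F a v).
  { intro w. destruct (Rle_dec a w); [destruct (Rle_dec w b); [apply hm; lra|]|].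
    - apply ex_RInt_Chasles with b; [apply hm; lra|].
      apply (ex_RInt_ext (fun y => p2 + q2 * y)).
      + rewrite Rmin_left, Rmax_right by lra. intros. symmetry.
        apply affine_extension_r; lra.
      + apply (@ex_RInt_continuous R_CompleteNormedModule). intros.
        apply continuous_affine.
    - apply (ex_RInt_ext (fun y => p1 + q1 * y)).
      + rewrite Rmin_right, Rmax_left by lra. intros. symmetry.
        apply affine_extension_l; lra.
      + apply (@ex_RInt_continuous R_CompleteNormedModule). intros.
        apply continuous_affine. }
  apply ex_RInt_Chasles with a; [apply ex_RInt_swap|]; apply ha.
Qed.

Lemma continuous_affine_extension (x : R) : a < b -> x <> a -> x <> b -> continuous F x.
Proof.
  intros hab ha hb.
  destruct (Rlt_dec x a); [|destruct (Rlt_dec b x)].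
  - apply (continuous_ext_loc _ (fun y => p1 + q1 * y)); [|apply continuous_affine].
    apply (locally_interval _ x m_infty a); simpl; auto.
    intros. symmetry. now apply affine_extension_l.
  - apply (continuous_ext_loc _ (fun y => p2 + q2 * y)); [|apply continuous_affine].
    apply (locally_interval _ x b p_infty); simpl; auto.
    intros. symmetry. now apply affine_extension_r.
  - apply (continuous_ext_loc _ f); [|now apply continuity_pt_filterlim].
    apply (locally_interval _ x a b); simpl; try lra.
    intros. symmetry. apply affine_extension_m. lra.
Qed.

(** The mean is the average of the extension against the triangular weight of half-width h, written
    as a second difference of a second antiderivative, so both derivatives can be read off. Its
    distance from f(s) averages [diff2 F s t] with weight (h-t)/h^2 of total mass 1/2, turning 3W/2
    into 3W/4. *)
Lemma zhuk_smoothing :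
  exists (g dg ddg : R -> R) (l : list R),
    (forall s, is_derive g s (dg s)) /\
    (forall s, continuity_pt dg s) /\
    (forall s, a < s < b -> ~ List.In s l ->
       is_derive dg s (ddg s) /\ Rabs (ddg s) <= 3 / 2 * W / h ^ 2) /\
    (forall s, a <= s <= b -> Rabs (f s - g s) <= 3 / 4 * W).
Proof.
  assert (hab : a < b) by lra.
  assert (hh2 : 0 < h ^ 2) by (apply pow_lt; lra).
  pose (Psi := RInt F a : R -> R). pose (Theta := RInt Psi a : R -> R).
  assert (hPsiI : forall y, is_RInt F a y (Psi y)).
  { intro y. apply (@RInt_correct R_CompleteNormedModule).
    now apply ex_RInt_affine_extension. }
  assert (hPsic : forall y, continuous Psi y).
  { intro y. apply (continuous_RInt_1 F a y Psi). now apply filter_forall. }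
  assert (hPc : forall y, continuity_pt Psi y)
    by (intro; apply continuity_pt_filterlim, hPsic).
  assert (hPsi : forall y, y <> a -> y <> b -> is_derive Psi y (F y)).
  { intros y h1 h2. apply (is_derive_RInt F Psi a); [now apply filter_forall|].
    now apply continuous_affine_extension. }
  assert (hTheta : forall y, is_derive Theta y (Psi y)).
  { intro y. apply (is_derive_RInt Psi Theta a); [|auto].
    apply filter_forall. intro z. apply (@RInt_correct R_CompleteNormedModule).
    now apply (@ex_RInt_continuous R_CompleteNormedModule). }
  assert (hd2 : forall (u du : R -> R) y t,
    is_derive u (y - t) (du (y - t)) -> is_derive u y (du y) ->
    is_derive u (y + t) (du (y + t)) ->
    is_derive (fun y => diff2 u y t / h ^ 2) y (diff2 du y t / h ^ 2)).
  { intros u du y t h1 h2 h3. unfold diff2. auto_derive.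
    - repeat split; try (eexists; eauto; fail); lra.
    - replace (Derive (fun x : R => u x) (y + - t)) with (du (y - t))
        by (symmetry; now apply is_derive_unique).
      replace (Derive (fun x : R => u x) y) with (du y)
        by (symmetry; now apply is_derive_unique).
      replace (Derive (fun x : R => u x) (y + t)) with (du (y + t))
        by (symmetry; now apply is_derive_unique).
      field. lra. }
  (* The listed points are those where s, s-h or s+h meets a jump of the extension at a or b. *)
  exists (fun y => diff2 Theta y h / h ^ 2), (fun y => diff2 Psi y h / h ^ 2),
    (fun y => diff2 F y h / h ^ 2),
    (a :: b :: (a + h) :: (b + h) :: (a - h) :: (b - h) :: nil)%list.
  split; [|split; [|split]].
  - intro s. now apply hd2.
  - intro s. unfold diff2.
    assert (hsh : forall e, continuity_pt (fun y => Psi (y + e)) s).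
    { intro e. apply (continuity_pt_comp (fun y => y + e) Psi); auto.
      apply (continuity_pt_is_derive _ _ 1). auto_derive; auto. }
    apply continuity_pt_mult;
      [apply continuity_pt_plus; [apply continuity_pt_minus; [apply (hsh (- h))|]|auto]
      | apply continuity_pt_const; intros ? ?; auto].
    apply continuity_pt_mult; [apply continuity_pt_const; intros ? ?; auto | auto].
  - intros s hs hn. simpl in hn. split.
    + apply hd2; apply hPsi; intro e; apply hn; lra.
    + unfold Rdiv. rewrite Rabs_mult, (Rabs_right (/ h ^ 2)).
      * apply Rmult_le_compat_r; [left; now apply Rinv_0_lt_compat|].
        apply diff2_affine_extension; lra.
      * left. now apply Rinv_0_lt_compat.
  - intros s hs.
    assert (hshift : forall (u du : R -> R) t e, is_derive u (s + t) (du (s + t)) ->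
      is_derive u (s - t) (du (s - t)) ->
      is_derive (fun t => u (s + t) + e * u (s - t)) t (du (s + t) - e * du (s - t))).
    { intros u du t e h1 h2. auto_derive.
      - repeat split; auto; eexists; eauto.
      - replace (Derive (fun x : R => u x) (s + t)) with (du (s + t))
          by (symmetry; now apply is_derive_unique).
        replace (Derive (fun x : R => u x) (s + - t)) with (du (s - t))
          by (symmetry; now apply is_derive_unique).
        ring. }
    assert (hTc : forall y, continuity_pt Theta y)
      by (intro; now apply (continuity_pt_is_derive _ _ (Psi y))).
    assert (hsc : forall (u : R -> R) e t, (forall y, continuity_pt u y) ->
      continuity_pt (fun t => u (s + t) + e * u (s - t)) t).
    { intros u e t hu. apply continuity_pt_plus.
      - apply (continuity_pt_comp (fun y => s + y) u); auto.
        apply (continuity_pt_is_derive _ _ 1). auto_derive; auto.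
      - apply continuity_pt_mult; [apply continuity_pt_const; intros ? ?; auto|].
        apply (continuity_pt_comp (fun y => s - y) u); auto.
        apply (continuity_pt_is_derive _ _ (-1)). auto_derive; auto. }
    assert (hpoly : forall c e t, continuity_pt (fun t => c * t + e * t ^ 2) t).
    { intros c e t. apply (continuity_pt_is_derive _ _ (c + e * (2 * t))).
      auto_derive; auto. ring. }
    assert (hPsi1 : forall t, 0 <= t <= h ->
      Rabs (Psi (s + t) - Psi (s - t) - 2 * f s * t) <= 3 / 2 * W * t).
    { intros t ht.
      (* The t-derivative is [diff2 F s t], except where s+t or s-t equals a or b. The zero terms
         only bring the polynomials into the form of [hpoly]. *)
      assert (hi := increment_le (a - s :: b - s :: s - a :: s - b :: nil)%list
        (fun t => (Psi (s + t) + -1 * Psi (s - t)) + (- 2 * f s * t + 0 * t ^ 2))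
        (fun t => 3 / 2 * W * t + 0 * t ^ 2)
        (fun t => diff2 F s t) (fun _ => 3 / 2 * W) 0 t ltac:(lra)).
      replace (Psi (s + t) - Psi (s - t) - 2 * f s * t) with
        (Psi (s + t) + -1 * Psi (s - t) + (- 2 * f s * t + 0 * t ^ 2)
         - (Psi (s + 0) + -1 * Psi (s - 0) + (- 2 * f s * 0 + 0 * 0 ^ 2)))
        by (rewrite Rplus_0_r, Rminus_0_r; ring).
      replace (3 / 2 * W * t) with (3 / 2 * W * t + 0 * t ^ 2 - (3 / 2 * W * 0 + 0 * 0 ^ 2))
        by ring.
      apply hi.
      - intros. apply continuity_pt_plus; auto.
      - intros. auto.
      - intros r hr' hn. simpl in hn. split; [|split].
        + replace (diff2 F s r) with ((F (s + r) - -1 * F (s - r)) + -2 * f s)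
            by (unfold diff2; rewrite (affine_extension_m s hs); ring).
          apply (is_derive_plus (fun t => Psi (s + t) + -1 * Psi (s - t))
            (fun t => -2 * f s * t + 0 * t ^ 2)).
          * apply (hshift Psi F); apply hPsi; intro e; apply hn; lra.
          * auto_derive; auto. ring.
        + auto_derive; auto. ring.
        + apply diff2_affine_extension; lra. }
    (* A second integration in t, from 3W/2 t to 3W/4 t^2; [Psi] is continuous, so no exceptional
       points remain. *)
    assert (hi := increment_le nil
      (fun t => (Theta (s + t) + 1 * Theta (s - t)) + (0 * t + - f s * t ^ 2))
      (fun t => 0 * t + 3 / 4 * W * t ^ 2)
      (fun t => Psi (s + t) - Psi (s - t) - 2 * f s * t)
      (fun t => 3 / 2 * W * t) 0 h ltac:(lra)).
    assert (hend : Rabs (h ^ 2 * (f s - diff2 Theta s h / h ^ 2)) <= h ^ 2 * (3 / 4 * W)).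
    { rewrite <- Rabs_Ropp.
      replace (- (h ^ 2 * (f s - diff2 Theta s h / h ^ 2))) with
        (Theta (s + h) + 1 * Theta (s - h) + (0 * h + - f s * h ^ 2)
         - (Theta (s + 0) + 1 * Theta (s - 0) + (0 * 0 + - f s * 0 ^ 2)))
        by (unfold diff2; rewrite Rplus_0_r, Rminus_0_r; field; lra).
      replace (h ^ 2 * (3 / 4 * W)) with
        (0 * h + 3 / 4 * W * h ^ 2 - (0 * 0 + 3 / 4 * W * 0 ^ 2)) by ring.
      apply hi.
      - intros. apply continuity_pt_plus; auto.
      - intros. auto.
      - intros r hr' _. split; [|split].
        + replace (Psi (s + r) - Psi (s - r) - 2 * f s * r)
            with (Psi (s + r) - 1 * Psi (s - r) + - 2 * f s * r) by ring.
          apply (is_derive_plus (fun t => Theta (s + t) + 1 * Theta (s - t))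
            (fun t => 0 * t + - f s * t ^ 2)).
          * now apply (hshift Theta Psi).
          * auto_derive; auto. ring.
        + auto_derive; auto. field.
        + apply hPsi1. lra. }
    rewrite Rabs_mult, Rabs_right in hend by lra.
    now apply Rmult_le_reg_l in hend.
Qed.

End ZhukSmoothing.

(** * Clamping, finiteness of the modulus, and the norm of E *)

(** The clamp is 1-Lipschitz with values in [a,b], so relative continuity of f gives continuity on
    the whole line without changing f on [a,b]. *)
Lemma continuity_pt_clamp (a b : R) (f : R -> R) (x : R) :
  a <= b -> continuous_on_segment a b f ->
  continuity_pt (fun y => f (Rmax a (Rmin b y))) x.
Proof.
  intros hab hf. apply continuity_pt_filterlim.
  set (cl := fun y => Rmax a (Rmin b y)).
  assert (hcl : forall y, a <= cl y <= b).
  { intro y. unfold cl. split; [apply Rmax_l|].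
    apply Rmax_lub; [lra | apply Rmin_l]. }
  apply (filterlim_comp _ _ _ cl f _ (within (fun y => a <= y <= b) (locally (cl x)))).
  - intros P [e he]. exists e. intros y hy. apply he; [|apply hcl].
    apply (Rle_lt_trans _ (Rabs (y - x))); [|exact hy].
    change (Rabs (cl y - cl x) <= Rabs (y - x)).
    unfold cl, Rmax, Rmin, Rabs.
    repeat (destruct Rle_dec || destruct Rcase_abs); lra.
  - apply (hf (cl x)). apply hcl.
Qed.

(** [real] sends infinite values to 0, so the supremum must first be shown finite: 4 K bounds the
    set when K bounds |f| on [a,b]. *)
Lemma omega2_ge (a b h y t : R) (f : R -> R) :
  a <= b -> continuous_on_segment a b f ->
  a <= y - t -> y + t <= b -> 0 <= t <= h ->
  Rabs (diff2 f y t) <= omega2 a b f h.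
Proof.
  intros hab hf h1 h2 ht.
  assert (hin : omega2_set a b f h (Rabs (diff2 f y t))).
  { exists y, t. repeat split; try lra. }
  assert (hbd : exists K, forall x, a <= x <= b -> Rabs (f x) <= K).
  { destruct (continuity_ab_maj (fun y => Rabs (f (Rmax a (Rmin b y)))) a b hab)
      as [u [hu _]].
    { intros z _. apply (continuity_pt_comp _ Rabs); [now apply continuity_pt_clamp|].
      apply Rcontinuity_abs. }
    eexists. intros x hx. specialize (hu x hx). cbv beta in hu.
    rewrite (Rmin_right b x), (Rmax_right a x) in hu by lra. exact hu. }
  destruct hbd as [K hK].
  unfold omega2. destruct (Lub_Rbar_correct (omega2_set a b f h)) as [ub lub].
  destruct (Lub_Rbar (omega2_set a b f h)) as [r | | ].
  - exact (ub _ hin).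
  - exfalso. apply (lub (Finite (4 * K))).
    intros z [y' [t' [i1 [i2 [i3 ->]]]]]. simpl.
    assert (k1 := hK _ i1). assert (k2 := hK _ i2). assert (k3 := hK y' ltac:(lra)).
    apply Rabs_le_between in k1. apply Rabs_le_between in k2.
    apply Rabs_le_between in k3. apply Rabs_le. lra.
  - exfalso. exact (ub _ hin).
Qed.

Lemma E_functional_ext (a b lam mu x : R) (f g : R -> R) :
  a <= x <= b -> (forall y, a <= y <= b -> f y = g y) ->
  E_functional a b f lam mu x = E_functional a b g lam mu x.
Proof.
  intros hx hfg. unfold E_functional. rewrite !hfg by lra.
  rewrite (RInt_ext f g); [reflexivity|].
  rewrite Rmin_left, Rmax_right by lra. intros. apply hfg. lra.
Qed.

(** The integral mean and the quadrature term are both averages, each contributing at most K. *)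
Lemma E_functional_dist (a b lam mu x K : R) (f g : R -> R) :
  a < b -> 0 <= lam <= 1 -> 0 <= mu <= 1 -> a <= x <= b ->
  (forall y, continuity_pt f y) -> (forall y, continuity_pt g y) ->
  (forall y, a <= y <= b -> Rabs (f y - g y) <= K) ->
  Rabs (E_functional a b f lam mu x) <= 2 * K + Rabs (E_functional a b g lam mu x).
Proof.
  intros hab hlam hmu hx hf hg hK.
  assert (hI : forall u, (forall y, continuity_pt u y) -> ex_RInt u a b).
  { intros u hu. apply (@ex_RInt_continuous R_CompleteNormedModule).
    intros z _. now apply continuity_pt_filterlim. }
  assert (hint : Rabs (RInt f a b - RInt g a b) <= (b - a) * K).
  { assert (e := RInt_minus f g a b (hI f hf) (hI g hg)).
    unfold minus, plus, opp in e. simpl in e.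
    unfold Rminus. rewrite <- e. apply abs_RInt_le_const; [lra | | exact hK].
    apply (@ex_RInt_minus R_NormedModule f g); auto. }
  assert (hmean : Rabs (1 / (b - a) * (RInt f a b - RInt g a b)) <= K).
  { rewrite Rabs_mult, (Rabs_right (1 / (b - a))).
    - apply (Rmult_le_reg_l (b - a)); [lra|].
      rewrite <- Rmult_assoc. replace ((b - a) * (1 / (b - a))) with 1 by (field; lra). lra.
    - left. apply Rdiv_lt_0_compat; lra. }
  assert (ka := hK a ltac:(lra)). assert (kb := hK b ltac:(lra)).
  assert (kx := hK x hx). assert (ky := hK (a + b - x) ltac:(lra)).
  assert (conv : forall s u v, 0 <= s <= 1 -> Rabs u <= K -> Rabs v <= K ->
    Rabs (s * u + (1 - s) * v) <= K).
  { intros s u v hs hu hv. apply Rabs_le_between in hu. apply Rabs_le_between in hv.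
    apply Rabs_le. nra. }
  assert (hquad := conv lam _ _ hlam (conv (1 / 2) _ _ ltac:(lra) ka kb)
    (conv mu _ _ hmu kx ky)).
  set (m := 1 / (b - a) * (RInt f a b - RInt g a b)) in *.
  set (q := lam * _ + _) in hquad.
  replace (E_functional a b f lam mu x) with (m - q + E_functional a b g lam mu x)
    by (unfold E_functional, m, q; field; lra).
  eapply Rle_trans; [apply Rabs_triang|]. apply Rplus_le_compat_r.
  unfold Rminus. eapply Rle_trans; [apply Rabs_triang|]. rewrite Rabs_Ropp. lra.
Qed.

Theorem mainTheorem3 (a b lam mu x C : R)
  (hab : a < b)
  (hlam : 0 <= lam <= 1)
  (hmu : 0 <= mu <= 1)
  (hx : a <= x <= (a + b) / 2)
  (hC : error_case a b lam mu x C)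
  (f : R -> R)
  (hf : continuous_on_segment a b f) :
  Rabs (E_functional a b f lam mu x) <= 9 / 2 * omega2 a b f (sqrt (C / 2)).
Proof.
  destruct (error_case_kernel a b lam mu x C hab hlam hx hC) as [hk hE].
  assert (hC0 : 0 < C <= 2 * ((b - a) / 2) ^ 2)
    by (apply (kernel_case_range _ ((a + b) / 2 - x) lam); auto; lra).
  set (h := sqrt (C / 2)). set (W := omega2 a b f h).
  assert (hh0 : 0 < h) by (apply sqrt_lt_R0; lra).
  assert (hh2 : h ^ 2 = C / 2) by (apply pow2_sqrt; lra).
  assert (hh : h <= (b - a) / 2) by (apply Rsqr_incr_0_var; unfold Rsqr; lra).
  pose (fc := fun y => f (Rmax a (Rmin b y))).
  assert (hfc : forall y, continuity_pt fc y)
    by (intro; apply continuity_pt_clamp; auto; lra).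
  assert (hfe : forall y, a <= y <= b -> f y = fc y).
  { intros y hy. unfold fc. now rewrite (Rmin_right b y), (Rmax_right a y) by lra. }
  rewrite hE, (E_functional_ext a b lam (1 / 2) x f fc); [|lra|auto].
  apply Rle_plus_epsilon. intros e he.
  (* W'/2 = W/2 + d is the error of the near-best lines, and (9/2) W' = (9/2) W + 9 d exceeds the
     target by exactly e. *)
  pose (d := e / 9). pose (W' := W + 2 * d).
  assert (hW : forall y t, a <= y - t -> y + t <= b -> 0 <= t <= h ->
    Rabs (diff2 fc y t) <= W).
  { intros y t h1 h2 h3. unfold diff2. rewrite <- !hfe by lra.
    apply (omega2_ge a b h y t f); auto; lra. }
  destruct (near_best_line a (a + 2 * h) fc W d) as [p1 [q1 hl]];
    [lra | unfold d; lra | auto | intros; apply hW; lra |].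
  destruct (near_best_line (b - 2 * h) b fc W d) as [p2 [q2 hr]];
    [lra | unfold d; lra | auto | intros; apply hW; lra |].
  destruct (zhuk_smoothing a b h W' p1 q1 p2 q2 fc)
    as [g [dg [ddg [l [hg [hdg [hddg hfg]]]]]]]; auto.
  { intros y t h1 h2 h3. specialize (hW y t h1 h2 h3). unfold W', d. lra. }
  { intros y hy. specialize (hl y hy). unfold W'. lra. }
  { intros y hy. specialize (hr y hy). unfold W'. lra. }
  assert (hEg := E_le_smooth a b lam x C (3 / 2 * W' / h ^ 2) l g dg ddg
    hab hlam hx hk hg hdg hddg).
  assert (hEf := E_functional_dist a b lam (1 / 2) x (3 / 4 * W') fc g hab hlam
    ltac:(lra) ltac:(lra) hfc (fun y => continuity_pt_is_derive g y (dg y) (hg y)) hfg).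
  replace (3 / 2 * W' / h ^ 2 * C) with (3 * W') in hEg by (rewrite hh2; field; lra).
  unfold W', d in *. lra.
Qed.
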